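(* Let $X$ be a locally compact metric space, let $f:X\to X$ be a PCM, and let $N\subset X$ be a compatible isolating neighborhood with respect to $f$. If the Conley index $C(N)=C(N,f)$ is nontrivial, then at least one of the following is true: 1. $\operatorname{Inv}_f(N)\neq\emptyset$; 2. there exists some $g$ adjoint with $f$, $g\neq f$, such that $\operatorname{Inv}_g(N)\neq\emptyset$.
   Context: **PCM.** A finite partition of $X$ is $\mathscr{A}=\{A_0,\dots,A_{n-1}\}$ with the $A_i\subset X$ pairwise disjoint and $\bigcup_i A_i=X$. A map $f:X\to X$ is finite piecewise continuous with respect to $\mathscr{A}$ if for each $i$ the restriction $f|_{A_i}$ extends to a continuous map $f_i:\operatorname{cl}(A_i)\to X$. A partition is minimal for $f$ if it cannot be coarsened (by uniting some of its pieces) to another finite partition for which $f$ is still piecewise continuous. A PCM is a finite piecewise continuous map of a locally compact metric space to itself, equipped with a minimal finite partition $\mathscr{A}=\{A_0,\dots,A_{n-1}\}$. **Discontinuity set and adjoint maps.** The discontinuity set is $D=\bigcup_{i\ne j}\operatorname{cl}(A_i)\cap\operatorname{cl}(A_j)$. A partition $\mathscr{B}=\{B_0,\dots,B_{n-1}\}$ of $X$ (same number of pieces) is adjoint to $\mathscr{A}$ if there is a permutation $\phi$ of $\{0,\dots,n-1\}$ with $A_i\setminus D=B_{\phi(i)}\setminus D$ for all $i$. A map $g:X\to X$ is adjoint with $f$ if for some such $\mathscr{B},\phi$ (with $B_{\phi(i)}\subset\operatorname{cl}(A_i)$, so that the formula makes sense) one has $g|_{B_{\phi(i)}}=f_i|_{B_{\phi(i)}}$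 for all $i$. **Invariant parts.** For a self-map $h:Y\to Y$ and $A\subset Y$, $\operatorname{Inv}_h^-(A)=\{x\in A:\exists \{x_k\}_{k\in\mathbb{Z},\,k\le 0}\subset A,\ x_0=x,\ h(x_k)=x_{k+1}\ \forall k<0\}$ and $\operatorname{Inv}_h(A)=\{x\in A:\exists\{x_k\}_{k\in\mathbb{Z}}\subset A,\ x_0=x,\ h(x_k)=x_{k+1}\ \forall k\in\mathbb{Z}\}$. A compact set $N\subset Y$ is an isolating neighborhood with respect to $h$ if $\operatorname{Inv}_h(N)\subset\operatorname{int}N$. An invariant set is a set $S$ with $\operatorname{Inv}_h(S)=S$; it is isolated if $S=\operatorname{Inv}_h(N)$ for some isolating neighborhood $N$. A compact set $N\subset X$ is a compatible isolating neighborhood with respect to the PCM $f$ if it is an isolating neighborhood with respect to $f$ and $\partial N\cap D$ contains no points of $\operatorname{Inv}_g^-(N)$, for any $g$ adjoint with $f$. **Coding and lifting.** Let $\Sigma_n^+=\{0,\dots,n-1\}^{\{0,1,2,\dots\}}$ with a product metric, e.g. $d_\Sigma(s,t)=\max\{\frac1{k+1}: s_k\ne t_k\}$ (and $0$ if $s=t$). The coding map $\tau:X\to\Sigma_n^+$ is $\tau(x)=(k_0,k_1,\dots)$ where $f^i(x)\in A_{k_i}$. Let $G_X=\{(x,\tau(x)):x\in X\}\subset X\times\Sigma_n^+$ with the max metric, and $\widetilde f:G_X\to G_X$, $\widetilde f(x,\tau(x))=(f(x),\tau(f(x)))$, which is continuous. Let $\operatorname{cl}(G_X)$ be the closure of $G_X$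 in $X\times\Sigma_n^+$ and let $\widehat f:\operatorname{cl}(G_X)\to\operatorname{cl}(G_X)$ be the continuous extension of $\widetilde f$, given by $\widehat f(x,s)=\lim_m\widetilde f(x_m,\tau(x_m))$ for $(x_m,\tau(x_m))\to(x,s)$. For $A\subset X$ let $\widetilde A=\{(x,\tau(x)):x\in A\}$ and let $\widehat A$ be the closure of $\widetilde A$ in $\operatorname{cl}(G_X)$. **Szymczak category.** For a category $\mathscr{K}$, $\operatorname{Endo}(\mathscr{K})$ has objects $(X,f)$ with $f\in\operatorname{Mor}_{\mathscr{K}}(X,X)$ and morphisms $(X,f)\to(X',f')$ the $\varphi\in\operatorname{Mor}_{\mathscr{K}}(X,X')$ with $\varphi f=f'\varphi$. $\operatorname{Sz}(\mathscr{K})$ has the same objects, and its morphisms $(X,f)\to(X',f')$ are equivalence classes $[\varphi,n]$ of pairs ($\varphi$ a morphism in $\operatorname{Endo}(\mathscr{K})$, $n\ge0$ an integer), where $(\varphi_1,n_1)\sim(\varphi_2,n_2)$ iff $\varphi_2\circ f^{n_1+k}=\varphi_1\circ f^{n_2+k}$ for some integer $k\ge0$. Composition is $[\varphi',n']\circ[\varphi,n]=[\varphi'\varphi,n'+n]$ and the identity is $[\mathrm{id},0]$. Let $\mathscr{T}'$ be the homotopy category of topological spaces and continuous maps. **Conley index of a continuous map.** Let $h:Y\to Y$ be a continuous map of a locally compact metric space and $S$ an isolated invariant set. An index pair for $S$ is a pair $P=(P_1,P_0)$ of compact sets $P_0\subset P_1\subset Y$ with (1) $S=\operatorname{Inv}_h(\operatorname{cl}(P_1\setminus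 P_0))\subset\operatorname{int}(P_1\setminus P_0)$; (2) $x\in P_0$ implies $h(x)\notin P_1\setminus P_0$; (3) $x\in P_1$, $h(x)\notin P_1$ implies $x\in P_0$. The index map $h_P:P_1/P_0\to P_1/P_0$ is $h_P([x])=[h(x)]$ if $x\in h^{-1}(P_1)$ and $h_P([x])=[P_0]$ otherwise; it is continuous. (If $P_0=\emptyset$, $P_1/P_0$ is $P_1$ with a disjoint point $[P_0]$ added.) The Conley index of $S$ is the isomorphism class of $(P_1/P_0,h_P)$ in $\operatorname{Sz}(\mathscr{T}')$, which is independent of the choice of index pair $P$. **Conley index of a PCM.** For a compatible isolating neighborhood $N$ of a PCM $f$, the set $\widehat N$ is taken as an isolating neighborhood of $\widehat f$, and $C(N)=C(N,f)$ is defined as the Conley index of $\operatorname{Inv}_{\widehat f}(\widehat N)$ with respect to the continuous map $\widehat f$. It is nontrivial if it is not the isomorphism class of the one-point space with its identity map. *)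

(* Defs.v *)
From HB Require Import structures.
From mathcomp Require Import all_boot all_order all_algebra all_fingroup.
From mathcomp Require Import all_classical all_reals all_analysis.
From mathcomp Require Import ring lra zify.
Import Order.TTheory GRing.Theory Num.Theory numFieldNormedType.Exports.

Set Implicit Arguments.
Unset Strict Implicit.
Unset Printing Implicit Defensive.

Local Open Scope classical_set_scope.
Local Open Scope ring_scope.

(* Equality of morphisms is an equivalence relation [heq], so that a morphism of *)
(* a quotient category is given by a representative.                            *)

Record category := Category {
  ob : Type;
  hom : ob -> ob -> Type;
  heq : forall a b, hom a b -> hom a b -> Prop;
  idm : forall a, hom a a;
  cmp : forall a b c, hom b c -> hom a b -> hom a c;
  heq_refl : forall a b (u : hom a b), heq u u;
  heq_sym : forall a b (u v : hom a b), heq u v -> heq v u;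
  heq_trans : forall a b (u v w : hom a b), heq u v -> heq v w -> heq u w;
  heq_cmp : forall a b c (v v' : hom b c) (u u' : hom a b),
    heq v v' -> heq u u' -> heq (cmp v u) (cmp v' u');
  cmpA : forall a b c d (w : hom c d) (v : hom b c) (u : hom a b),
    heq (cmp w (cmp v u)) (cmp (cmp w v) u);
  cmp1m : forall a b (u : hom a b), heq (cmp (idm b) u) u;
  cmpm1 : forall a b (u : hom a b), heq (cmp u (idm a)) u }.

Arguments hom {_} _ _.
Arguments heq {_ _ _} _ _.
Arguments idm {_} _.
Arguments cmp {_ _ _ _} _ _.

Definition isomorphic (K : category) (a b : ob K) : Prop :=
  exists (u : hom a b) (v : hom b a),
    heq (cmp v u) (idm a) /\ heq (cmp u v) (idm b).

Section szymczak.
Variable K : category.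

Record endo := Endo { endo_ob : ob K; endo_map : hom endo_ob endo_ob }.

Record endo_hom (a b : endo) := EndoHom {
  endo_fun :> hom (endo_ob a) (endo_ob b);
  endo_comm : heq (cmp endo_fun (endo_map a)) (cmp (endo_map b) endo_fun) }.

Fixpoint iterm (a : ob K) (f : hom a a) (n : nat) : hom a a :=
  if n is m.+1 then cmp f (iterm f m) else idm a.

Lemma itermD (a : ob K) (f : hom a a) (m n : nat) :
  heq (iterm f (m + n)) (cmp (iterm f m) (iterm f n)).
Proof.
elim: m => [|m IH] /=; first exact/heq_sym/cmp1m.
exact: heq_trans (heq_cmp (heq_refl f) IH) (cmpA _ _ _).
Qed.

Lemma endo_iterm (a b : endo) (u : endo_hom a b) (n : nat) :
  heq (cmp u (iterm (endo_map a) n)) (cmp (iterm (endo_map b) n) u).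
Proof.
elim: n => [|n IH] /=; first exact: heq_trans (cmpm1 _) (heq_sym (cmp1m _)).
apply: heq_trans (cmpA _ _ _) _.
apply: heq_trans (heq_cmp (endo_comm u) (heq_refl _)) _.
apply: heq_trans (heq_sym (cmpA _ _ _)) _.
apply: heq_trans (heq_cmp (heq_refl _) IH) _.
exact: cmpA.
Qed.

Lemma endo_id_comm (a : endo) :
  heq (cmp (idm (endo_ob a)) (endo_map a)) (cmp (endo_map a) (idm (endo_ob a))).
Proof. exact: heq_trans (cmp1m _) (heq_sym (cmpm1 _)). Qed.

Definition endo_id (a : endo) : endo_hom a a := EndoHom (endo_id_comm a).

Lemma endo_cmp_comm (a b c : endo) (v : endo_hom b c) (u : endo_hom a b) :
  heq (cmp (cmp v u) (endo_map a)) (cmp (endo_map c) (cmp v u)).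
Proof.
apply: heq_trans (heq_sym (cmpA _ _ _)) _.
apply: heq_trans (heq_cmp (heq_refl _) (endo_comm u)) _.
apply: heq_trans (cmpA _ _ _) _.
apply: heq_trans (heq_cmp (endo_comm v) (heq_refl _)) _.
exact: heq_sym (cmpA _ _ _).
Qed.

Definition endo_cmp (a b c : endo) (v : endo_hom b c) (u : endo_hom a b) :
  endo_hom a c := EndoHom (endo_cmp_comm v u).

(* The pair (phi, n) represents the class [phi, n]. *)
Definition sz_hom (a b : endo) : Type := (endo_hom a b * nat)%type.

Definition sz_eq (a b : endo) (p q : sz_hom a b) : Prop :=
  exists k : nat, heq (cmp q.1 (iterm (endo_map a) (p.2 + k)))
                      (cmp p.1 (iterm (endo_map a) (q.2 + k))).

Definition sz_id (a : endo) : sz_hom a a := (endo_id a, 0%N).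

Definition sz_cmp (a b c : endo) (q : sz_hom b c) (p : sz_hom a b) :
  sz_hom a c := (endo_cmp q.1 p.1, (q.2 + p.2)%N).

Lemma heq_itermD (a : endo) (b : ob K) (u v : hom (endo_ob a) b) (m n l : nat) :
  heq (cmp u (iterm (endo_map a) m)) (cmp v (iterm (endo_map a) n)) ->
  heq (cmp u (iterm (endo_map a) (m + l))) (cmp v (iterm (endo_map a) (n + l))).
Proof.
move=> H; apply: heq_trans (heq_cmp (heq_refl _) (itermD _ _ _)) _.
apply: heq_trans (cmpA _ _ _) _.
apply: heq_trans (heq_cmp H (heq_refl _)) _.
apply: heq_trans (heq_sym (cmpA _ _ _)) _.
exact: heq_cmp (heq_refl _) (heq_sym (itermD _ _ _)).
Qed.

Lemma sz_eq_refl (a b : endo) (p : sz_hom a b) : sz_eq p p.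
Proof. by exists 0%N; exact: heq_refl. Qed.

Lemma sz_eq_sym (a b : endo) (p q : sz_hom a b) : sz_eq p q -> sz_eq q p.
Proof. by case=> k H; exists k; exact: heq_sym. Qed.

Lemma sz_eq_trans (a b : endo) (p q r : sz_hom a b) :
  sz_eq p q -> sz_eq q r -> sz_eq p r.
Proof.
case: p q r => [u1 n1] [u2 n2] [u3 n3] [k /= H1] [l /= H2].
exists (n2 + k + l)%N => /=.
have := heq_itermD (n1 + k)%N H2; have := heq_itermD (n3 + l)%N H1.
rewrite (_ : n2 + l + (n1 + k) = n1 + (n2 + k + l))%N; last by ring.
rewrite (_ : n3 + l + (n1 + k) = n1 + k + (n3 + l))%N; last by ring.
rewrite (_ : n2 + k + (n3 + l) = n3 + (n2 + k + l))%N; last by ring.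
by move=> H3 H4; exact: heq_trans H4 H3.
Qed.

Lemma sz_eq_cmp (a b c : endo) (q q' : sz_hom b c) (p p' : sz_hom a b) :
  sz_eq q q' -> sz_eq p p' -> sz_eq (sz_cmp q p) (sz_cmp q' p').
Proof.
case: p p' q q' => [u m] [u' m'] [v n] [v' n'] [k /= Hv] [l /= Hu].
exists (k + l)%N => /=.
have swap (w : hom (endo_ob b) (endo_ob c)) (x : endo_hom a b) i j :
    heq (cmp (cmp w x) (iterm (endo_map a) (i + j)))
        (cmp (cmp w (iterm (endo_map b) i)) (cmp x (iterm (endo_map a) j))).
  apply: heq_trans (heq_cmp (heq_refl _) (itermD _ _ _)) _.
  apply: heq_trans (cmpA _ _ _) _.
  apply: heq_trans _ (heq_sym (cmpA _ _ _)).
  apply: heq_cmp (heq_refl _).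
  apply: heq_trans (heq_sym (cmpA _ _ _)) _.
  apply: heq_trans (heq_cmp (heq_refl _) (endo_iterm _ _)) _.
  exact: cmpA.
rewrite (_ : n + m + (k + l) = (n + k) + (m + l))%N; last by ring.
rewrite (_ : n' + m' + (k + l) = (n' + k) + (m' + l))%N; last by ring.
apply: heq_trans (swap _ _ _ _) _.
apply: heq_trans (heq_cmp Hv Hu) _.
exact: heq_sym (swap _ _ _ _).
Qed.

Lemma sz_cmpA (a b c d : endo)
    (r : sz_hom c d) (q : sz_hom b c) (p : sz_hom a b) :
  sz_eq (sz_cmp r (sz_cmp q p)) (sz_cmp (sz_cmp r q) p).
Proof.
exists 0%N; rewrite /= addnA.
exact: heq_cmp (heq_sym (cmpA _ _ _)) (heq_refl _).
Qed.

Lemma sz_cmp1m (a b : endo) (p : sz_hom a b) : sz_eq (sz_cmp (sz_id b) p) p.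
Proof.
exists 0%N; rewrite /= add0n.
exact: heq_cmp (heq_sym (cmp1m _)) (heq_refl _).
Qed.

Lemma sz_cmpm1 (a b : endo) (p : sz_hom a b) : sz_eq (sz_cmp p (sz_id a)) p.
Proof.
exists 0%N; rewrite /= !addn0.
exact: heq_cmp (heq_sym (cmpm1 _)) (heq_refl _).
Qed.

Definition Sz : category := Category sz_eq_refl sz_eq_sym sz_eq_trans
  sz_eq_cmp sz_cmpA sz_cmp1m sz_cmpm1.

End szymczak.

Section homotopy_category.
Variable R : realType.

Definition homotopic (X Y : topologicalType) (f g : X -> Y) : Prop :=
  exists H : X * R -> Y,
    [/\ {within [set: X] `*` `[0, 1], continuous H},
        forall x, H (x, 0) = f x & forall x, H (x, 1) = g x].

Lemma cvg_to_pair (T : Type) (F : set_system T) (X Y : topologicalType)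
    (f : T -> X) (g : T -> Y) (x : X) (y : Y) : Filter F ->
  f @ F --> x -> g @ F --> y -> (fun t => (f t, g t)) @ F --> (x, y).
Proof.
move=> FF cf cg W [[A B] [/= xA yB] ABW]; have FA : F (f @^-1` A) by exact: cf.
have FB : F (g @^-1` B) by exact: cg.
suff : F [set t | W (f t, g t)] by [].
by apply: filterS2 FA FB => t At Bt; exact: (ABW (f t, g t)).
Qed.

Lemma continuous_fst (X Y : topologicalType) : continuous (@fst X Y).
Proof. by move=> z; exact: cvg_fst. Qed.

Lemma continuous_snd (X Y : topologicalType) : continuous (@snd X Y).
Proof. by move=> z; exact: cvg_snd. Qed.

Lemma within_comp (X Y Z : topologicalType) (A : set X) (B : set Y)
    (p : X -> Y) (H : Y -> Z) :
  continuous p -> (forall x, A x -> B (p x)) ->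
  {within B, continuous H} -> {within A, continuous (H \o p)}.
Proof.
move=> cp pAB /subspace_continuousP cH; apply/subspace_continuousP => x Ax.
have cHx := cH _ (pAB _ Ax); move=> W /cHx HW.
have {}HW : nbhs x (fun y => B (p y) -> W (H (p y))) by exact: (cp x _ HW).
suff : nbhs x (fun y => A y -> W (H (p y))) by [].
by apply: filterS HW => y HBy Ay; exact/HBy/pAB.
Qed.

Lemma within_eq (X Y : topologicalType) (A : set X) (f g : X -> Y) :
  (forall x, A x -> f x = g x) ->
  {within A, continuous f} -> {within A, continuous g}.
Proof.
by move=> fg; apply: subspace_eq_continuous => x /set_mem; exact: fg.
Qed.

Lemma homotopic_refl (X Y : topologicalType) (f : continuousType X Y) :
  homotopic f f.
Proof.
exists (f \o fst); split => //; apply: continuous_subspaceT => z.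
by apply: continuous_comp; [exact: continuous_fst|exact: cts_fun].
Qed.

Lemma continuous_time (X : topologicalType) (a b : R) :
  continuous (fun z : X * R => (z.1, a * z.2 + b)).
Proof.
move=> z; apply: cvg_to_pair => /=; first exact: continuous_fst.
apply: cvgD; last exact: cvg_cst.
by apply: cvgM; [exact: cvg_cst|exact: continuous_snd].
Qed.

Lemma homotopic_sym (X Y : topologicalType) (f g : X -> Y) :
  homotopic f g -> homotopic g f.
Proof.
case=> H [cH H0 H1]; exists (H \o (fun z => (z.1, -1 * z.2 + 1))); split.
- apply: within_comp cH; first exact: continuous_time.
  move=> [x t] [_] /=; rewrite !in_itv /= => /andP[t0 t1]; split=> //.
  by apply/andP; split; lra.
- by move=> x /=; rewrite mulr0 add0r.
- by move=> x /=; rewrite mulr1 addNr.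
Qed.

Lemma homotopic_trans (X Y : topologicalType) (f g h : X -> Y) :
  homotopic f g -> homotopic g h -> homotopic f h.
Proof.
case=> H [cH H0 H1] [G [cG G0 G1]].
pose F (z : X * R) := if z.2 <= 2^-1 then H (z.1, 2 * z.2 + 0)
                      else G (z.1, 2 * z.2 + -1).
exists F; split.
- have -> : [set: X] `*` `[0, 1] =
      ([set: X] `*` `[0, 2^-1]) `|` ([set: X] `*` `[2^-1, (1 : R)]).
    apply/seteqP; split => -[x t] /=; rewrite !in_itv /=.
      case=> _ /andP[t0 t1]; case: (leP t 2^-1) => ht; [left|right]; split=> //.
        by rewrite t0.
      by rewrite t1 ltW.
    by case=> -[_ /andP[t0 t1]]; split=> //; apply/andP; split; lra.
  have clX (a b : R) : closed ([set: X] `*` `[a, b]).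
    rewrite setTX; apply: closed_comp; last exact: itv_closed.
    by move=> z _; exact: continuous_snd.
  apply: withinU_continuous => //.
    apply: (@within_eq _ _ _
      (H \o (fun z : X * R => (z.1, 2 * z.2 + 0)))).
      move=> [x t] /=; rewrite in_itv /= => -[_ /andP[_ t1]].
      by rewrite /F /= t1.
    apply: within_comp cH; first exact: continuous_time.
    move=> [x t] [_] /=; rewrite !in_itv /= => /andP[t0 t1]; split=> //.
    by apply/andP; split; lra.
  apply: (@within_eq _ _ _
    (G \o (fun z : X * R => (z.1, 2 * z.2 + -1)))).
    move=> [x t] /=; rewrite in_itv /= => -[_ /andP[t0 _]].
    rewrite /F /=; case: ifPn => // t1; have -> : t = 2^-1 by lra.
    by rewrite addr0 mulfV// subrr G0 H1.
  apply: within_comp cG; first exact: continuous_time.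
  move=> [x t] [_] /=; rewrite !in_itv /= => /andP[t0 t1]; split=> //.
  by apply/andP; split; lra.
- by move=> x; rewrite /F /= invr_ge0 ler0n mulr0 addr0.
- move=> x; rewrite /F /= ifF; last by apply/negbTE; rewrite -ltNge; lra.
  by rewrite -[RHS]G1; congr (G (_, _)); lra.
Qed.

Lemma homotopic_cmp (X Y Z : topologicalType)
    (g g' : continuousType Y Z) (f f' : continuousType X Y) :
  homotopic g g' -> homotopic f f' -> homotopic (g \o f) (g' \o f').
Proof.
move=> [G [cG G0 G1]] [F [cF F0 F1]].
apply: (@homotopic_trans _ _ _ (g \o f')).
  exists (g \o F); split.
  - move=> z; apply: (@continuous_comp (subspace _)); first exact: cF.
    exact: cts_fun.
  - by move=> x /=; rewrite F0.
  - by move=> x /=; rewrite F1.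
exists (G \o (fun z => (f' z.1, z.2))); split.
- apply: within_comp cG; last by move=> [x t] [].
  move=> z; apply: cvg_to_pair => /=; last exact: continuous_snd.
  by apply: continuous_comp; [exact: continuous_fst|exact: cts_fun].
- by move=> x /=; rewrite G0.
- by move=> x /=; rewrite G1.
Qed.

Definition hTop : category :=
  @Category topologicalType (fun X Y => continuousType X Y)
    (fun X Y f g => homotopic f g) (fun X => idfun) (fun X Y Z g f => g \o f)
    homotopic_refl (fun X Y f g => @homotopic_sym X Y f g)
    (fun X Y f g h => @homotopic_trans X Y f g h)
    homotopic_cmp
    (fun _ _ _ _ h g f => homotopic_refl (h \o g \o f))
    (fun _ _ f => homotopic_refl f) (fun _ _ f => homotopic_refl f).

Definition sz_object (X : topologicalType) (f : X -> X) (cf : continuous f) :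
  ob (Sz hTop) := @Endo hTop X (mkcts cf : continuousType X X).

Definition sz_point : ob (Sz hTop) :=
  @Endo hTop (discrete_topology unit) (@idm hTop (discrete_topology unit)).

End homotopy_category.

Section invariance.
Variables (Y : topologicalType) (h : Y -> Y).

Definition invariant_part_minus (A : set Y) : set Y := [set x | exists x_ : int -> Y,
  [/\ x_ 0 = x, forall k : int, k <= 0 -> A (x_ k)
    & forall k : int, k < 0 -> h (x_ k) = x_ (k + 1)]].

Definition invariant_part (A : set Y) : set Y := [set x | exists x_ : int -> Y,
  [/\ x_ 0 = x, forall k : int, A (x_ k)
    & forall k : int, h (x_ k) = x_ (k + 1)]].

Definition isolating_neighborhood (N : set Y) : Prop :=
  compact N /\ invariant_part N `<=` interior N.

End invariance.

Section pair_quotient.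
Variables (Y : topologicalType) (P1 P0 : set Y).

(* The points of P1/P0: [None] is the class [P0] (a new isolated point when P0 *)
(* is empty), and [Some y] is the class of y in P1 \ P0.                       *)
Definition pair_quotient : Type := option (set_type (P1 `\` P0)).

HB.instance Definition _ := Choice.on pair_quotient.

(* The class of y, where by convention every point outside P1 is sent to [P0]. *)
Definition pair_class (y : Y) : pair_quotient :=
  if pselect ((P1 `\` P0) y) is left yP then Some (exist _ y (mem_set yP))
  else None.

Definition pair_open (U : set pair_quotient) : Prop :=
  open [set p : set_type P1 | U (pair_class (set_val p))].

Lemma pair_openT : pair_open setT.
Proof. exact: openT. Qed.

Lemma pair_openI : setI_closed pair_open.
Proof. by move=> U V oU oV; exact: openI. Qed.

Lemma pair_open_bigcup (I : Type) (U : I -> set pair_quotient) :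
  (forall i, pair_open (U i)) -> pair_open (\bigcup_i U i).
Proof. by move=> oU; apply: bigcup_open => i _; exact: oU. Qed.

HB.instance Definition _ := isOpenTopological.Build pair_quotient
  pair_openT pair_openI pair_open_bigcup.

Lemma pair_classT (y : Y) (yP : y \in P1 `\` P0) :
  pair_class y = Some (exist _ y yP).
Proof.
rewrite /pair_class; case: pselect => [yP'|]; last by case; exact: set_mem.
by congr (Some (exist _ _ _)); exact: Prop_irrelevance.
Qed.

Lemma pair_classF (y : Y) : ~ (P1 `\` P0) y -> pair_class y = None.
Proof. by rewrite /pair_class; case: pselect. Qed.

End pair_quotient.

Section conley_index.
Variables (R : realType) (Y : topologicalType) (h : Y -> Y).

Definition index_pair (S P1 P0 : set Y) : Prop :=
  [/\ compact P1, compact P0 & P0 `<=` P1] /\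
  [/\ S = invariant_part h (closure (P1 `\` P0)) /\ S `<=` interior (P1 `\` P0),
      forall x, P0 x -> ~ (P1 `\` P0) (h x)
    & forall x, P1 x -> ~ P1 (h x) -> P0 x].

(* [pair_class] sends h(y) to [P0] when h(y) is not in P1. *)
Definition index_map (P1 P0 : set Y) (z : pair_quotient P1 P0) :
    pair_quotient P1 P0 :=
  if z is Some y then pair_class P1 P0 (h (set_val y)) else None.

Hypotheses (hY : hausdorff_space Y) (hc : continuous h).

Lemma index_map_class (S P1 P0 : set Y) (y : Y) :
  index_pair S P1 P0 -> P1 y ->
  index_map (pair_class P1 P0 y) = pair_class P1 P0 (h y).
Proof.
move=> [_ [_ H2 _]] P1y; have [P0y|P0y] := pselect (P0 y).
  by rewrite [in LHS]pair_classF => [|[]//] /=; rewrite pair_classF//; exact: H2.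
by rewrite (@pair_classT _ P1 P0 y (mem_set (conj P1y P0y))).
Qed.

Lemma index_map_continuous (S P1 P0 : set Y) :
  index_pair S P1 P0 -> continuous (@index_map P1 P0).
Proof.
move=> HP; have [[cP1 cP0 P01] [_ H2 H3]] := HP.
have clP1 := compact_closed hY cP1; have clP0 := compact_closed hY cP0.
apply/continuousP => U oU.
have [V oV VE] : exists2 V : set Y, open V &
    (set_val : set_type P1 -> Y) @^-1` V =
    [set p : set_type P1 | U (pair_class P1 P0 (set_val p))] by exact: oU.
have {}VE y : P1 y -> V y <-> U (pair_class P1 P0 y).
  move=> P1y; pose p : set_type P1 := exist _ y (mem_set P1y).
  by have /seteqP[/(_ p) VU /(_ p) UV] := VE; split; [exact: VU|exact: UV].
pose W := if pselect (U None) then h @^-1` (V `|` ~` P1)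
          else h @^-1` V `&` ~` P0.
have oW : open W.
  rewrite /W; case: pselect => _ /=.
    by apply: open_comp; [move=> *; exact: hc|apply: openU => //; exact: closed_openC].
  apply: openI; last exact: closed_openC.
  by apply: open_comp => // *; exact: hc.
exists W => //; apply/seteqP; split => -[y yP] /=;
  have P1y := set_mem yP; rewrite !set_valE /= (index_map_class HP)//.
- rewrite /W; case: pselect => /= UN.
    case=> [Vy|nP1y]; last by rewrite pair_classF => // -[].
    have [P1hy|nP1hy] := pselect (P1 (h y)); first exact/VE.
    by rewrite pair_classF => // -[].
  case=> Vy nP0y; apply/VE => //.
  by apply: contrapT => nP1hy; exact/nP0y/H3.
- rewrite /W; case: pselect => /= UN Uhy.
    have [P1hy|nP1hy] := pselect (P1 (h y)); last by right.
    by left; exact/VE.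
  have [P1P0hy|n] := pselect ((P1 `\` P0) (h y)).
    split; first by apply/VE => //; case: P1P0hy.
    by move=> P0y; exact: H2 P1P0hy.
  by rewrite pair_classF in Uhy.
Qed.

Definition index_object (S P1 P0 : set Y) (HP : index_pair S P1 P0) :
  ob (Sz (hTop R)) := sz_object R (index_map_continuous HP).

(* An isomorphism class is given as a class of objects of the Szymczak category; *)
(* all index pairs of an isolated invariant set S give the same one.            *)
Definition conley_index (S : set Y) : ob (Sz (hTop R)) -> Prop :=
  fun Z => exists (P1 P0 : set Y) (HP : index_pair S P1 P0),
    isomorphic Z (index_object HP).

End conley_index.

Definition nontrivial_index (R : realType) (C : ob (Sz (hTop R)) -> Prop) :
  Prop := C <> (fun Z => isomorphic Z (sz_point R)).

Definition shift_space (R : realType) (n : nat) : Type := nat -> 'I_n.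

Section shift_space.
Variables (R : realType) (n : nat).

HB.instance Definition _ := Choice.on (shift_space R n).

Implicit Types s t : shift_space R n.

(* [sup set0] is 0, which covers the case s = t. *)
Definition shift_dist s t : R :=
  sup [set k.+1%:R^-1 | k in [set k | s k != t k]].

Lemma shift_dist_ub s t k : s k != t k -> k.+1%:R^-1 <= shift_dist s t.
Proof.
move=> st; apply: ub_le_sup; last by exists k.
by exists 1 => _ [j _ <-]; rewrite invf_le1// ler1n.
Qed.

Lemma shift_dist_le s t (e : R) : 0 <= e ->
  (forall k, s k != t k -> k.+1%:R^-1 <= e) -> shift_dist s t <= e.
Proof.
move=> e0 H; have [[k stk]|ne] := pselect (exists k, s k != t k).
  by apply: ge_sup; [exists k.+1%:R^-1, k|move=> _ [j stj <-]; exact: H].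
rewrite /shift_dist (_ : [set _ | _ in _] = set0) ?sup0//.
by apply/seteqP; split => // y [k stk _]; apply: ne; exists k.
Qed.

Lemma shift_distxx s : shift_dist s s = 0.
Proof.
rewrite /shift_dist (_ : [set _ | _ in _] = set0) ?sup0//.
by apply/seteqP; split => // y [k /=]; rewrite eqxx.
Qed.

Lemma shift_dist_positivity s t : shift_dist s t = 0 -> s = t.
Proof.
move=> st0; apply/funext => k; apply/eqP; apply: contrapT => /negP stk.
by have := shift_dist_ub stk; rewrite st0 leNgt invr_gt0 ltr0n.
Qed.

Lemma shift_dist_sym s t : shift_dist s t = shift_dist t s.
Proof.
rewrite /shift_dist (_ : [set k | s k != t k] = [set k | t k != s k])//.
by apply/seteqP; split => k /=; rewrite eq_sym.
Qed.

Lemma shift_dist_ge0 s t : 0 <= shift_dist s t.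
Proof.
have [[k stk]|ne] := pselect (exists k, s k != t k).
  by apply: le_trans (shift_dist_ub stk); rewrite invr_ge0.
rewrite (_ : s = t) ?shift_distxx//; apply/funext => k; apply/eqP.
by apply: contrapT => /negP stk; apply: ne; exists k.
Qed.

Lemma shift_dist_triangle t s u :
  shift_dist s u <= shift_dist s t + shift_dist t u.
Proof.
apply: shift_dist_le => [|k suk]; first by rewrite addr_ge0 ?shift_dist_ge0.
have [stk|/shift_dist_ub stk] := eqVneq (s k) (t k).
  rewrite -[leLHS]add0r lerD ?shift_dist_ge0//.
  by apply: shift_dist_ub; rewrite -stk.
by rewrite -[leLHS]addr0 lerD ?shift_dist_ge0.
Qed.

HB.instance Definition _ := @isMetric.Build R (shift_space R n) shift_dist
  shift_distxx shift_dist_positivity shift_dist_sym shift_dist_triangle.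

Definition symbol_shift s : shift_space R n := fun k => s k.+1.

Lemma near_symbol s : \forall t \near s, t 0%N = s 0%N.
Proof.
have : nbhs s (ball s (1 : R)) by exact: nbhsx_ballx.
apply: filterS => t; rewrite ballEmdist /= => st.
apply/eqP; apply: contrapT => /negP; rewrite eq_sym => /shift_dist_ub.
by rewrite invr1 leNgt st.
Qed.

Lemma shift_continuous : continuous symbol_shift.
Proof.
move=> s W /nbhs_ballP[e /= e0 eW].
have Hs : nbhs s (ball s (e / 2)) by apply: nbhsx_ballx; rewrite divr_gt0.
suff : nbhs s [set t | W (symbol_shift t)] by [].
apply: filterS Hs => t; rewrite ballEmdist /= => st.
apply: eW; rewrite ballEmdist /=.
suff : shift_dist (symbol_shift s) (symbol_shift t) <= 2 * shift_dist s t.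
  move=> /le_lt_trans; apply; rewrite -ltr_pdivlMl//.
  by rewrite mulrC; exact: st.
apply: shift_dist_le => [|k /(@shift_dist_ub s t k.+1) H].
  by rewrite mulr_ge0 ?shift_dist_ge0.
apply: (@le_trans _ _ (2 * k.+2%:R^-1)); last by rewrite ler_wpM2l.
rewrite -ler_pdivrMl// -invfM lef_pV2 ?posrE ?mulr_gt0 ?ltr0n//.
by rewrite -natrM ler_nat; lia.
Qed.

End shift_space.

Section pcm.
Variables (R : realType) (X : metricType R).

(* The pieces are indexed and may be empty. *)
Definition finite_partition (n : nat) (A : 'I_n -> set X) : Prop :=
  trivIset [set: 'I_n] A /\ \bigcup_i A i = [set: X].

(* [f_] is a continuous extension of f|A to cl(A); its values outside cl(A) are *)
(* irrelevant.                                                                  *)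
Definition continuous_extension (f : X -> X) (A : set X) (f_ : X -> X) : Prop :=
  {within closure A, continuous f_} /\ forall x, A x -> f_ x = f x.

Definition piecewise_continuous (n : nat) (A : 'I_n -> set X) (f : X -> X) :
    Prop :=
  finite_partition A /\
  forall i, exists f_ : X -> X, continuous_extension f (A i) f_.

Definition coarsening (n m : nat) (A : 'I_n -> set X) (c : 'I_n -> 'I_m) :
    'I_m -> set X :=
  fun j => \bigcup_(i in [set i | c i = j]) A i.

Definition minimal_partition (n : nat) (A : 'I_n -> set X) (f : X -> X) :
    Prop :=
  forall (m : nat) (c : 'I_n -> 'I_m), (m < n)%N ->
    (forall j, exists i, c i = j) -> ~ piecewise_continuous (coarsening A c) f.

Record pcm := Pcm {
  pcm_fun :> X -> X;
  pcm_size : nat;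
  pcm_piece : 'I_pcm_size -> set X;
  pcm_continuous : piecewise_continuous pcm_piece pcm_fun;
  pcm_minimal : minimal_partition pcm_piece pcm_fun }.

Variable f : pcm.
Local Notation n := (pcm_size f).
Local Notation A := (@pcm_piece f).

Definition discontinuity_set : set X :=
  [set x | exists i j : 'I_n, [/\ i != j, closure (A i) x & closure (A j) x]].

Definition adjoint_partition (B : 'I_n -> set X) (phi : {perm 'I_n}) : Prop :=
  finite_partition B /\
  forall i, A i `\` discontinuity_set = B (phi i) `\` discontinuity_set.

Definition adjoint_map (g : X -> X) : Prop :=
  exists (B : 'I_n -> set X) (phi : {perm 'I_n}),
    [/\ adjoint_partition B phi,
        forall i, B (phi i) `<=` closure (A i)
      & forall i, exists2 f_ : X -> X, continuous_extension f (A i) f_ &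
          forall x, B (phi i) x -> g x = f_ x].

Definition compatible_isolating_neighborhood (N : set X) : Prop :=
  isolating_neighborhood f N /\
  forall g, adjoint_map g ->
    (closure N `\` interior N) `&` discontinuity_set `&`
      invariant_part_minus g N = set0.

Lemma pcm_cover (x : X) : exists i, A i x.
Proof.
have [[_ AT] _] := pcm_continuous f.
have : [set: X] x by [].
by rewrite -AT => -[i _ Aix]; exists i.
Qed.

Definition coding (x : X) : shift_space R n :=
  fun k => sval (cid (pcm_cover (iter k f x))).

Lemma codingP (x : X) (k : nat) : A (coding x k) (iter k f x).
Proof. by rewrite /coding; case: cid. Qed.

Lemma coding_shift (x : X) : coding (f x) = symbol_shift (coding x).
Proof. by apply/funext => k; rewrite /coding /symbol_shift -iterSr. Qed.

(* The set G_X, and the space cl(G_X) with its subspace topology. *)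
Definition coding_graph : set (X * shift_space R n) :=
  range (fun x => (x, coding x)).

Definition cl_graph : Type := set_type (closure coding_graph).

HB.instance Definition _ := Topological.on cl_graph.

Lemma coding_graph_closure (x : X) :
  (x, coding x) \in closure coding_graph.
Proof. by apply: mem_set; apply: subset_closure; exists x. Qed.

Definition graph_point (x : X) : cl_graph :=
  exist _ (x, coding x) (coding_graph_closure x).

Lemma cl_graph_val_continuous : continuous (set_val : cl_graph -> _).
Proof. exact: initial_continuous. Qed.

Lemma cl_graph_hausdorff : hausdorff_space cl_graph.
Proof.
move=> p q pq.
have sep (Z : topologicalType) (u : cl_graph -> Z) :
    hausdorff_space Z -> continuous u -> u p = u q.
  move=> hZ cu; apply: hZ => U V /cu pU /cu qV.
  by have [z [Uz Vz]] := pq _ _ pU qV; exists (u z).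
apply: val_inj; rewrite [LHS]surjective_pairing [RHS]surjective_pairing.
congr (_, _).
- apply: (sep _ (fst \o set_val)); first exact: metric_hausdorff.
  move=> z; apply: continuous_comp; first exact: cl_graph_val_continuous.
  exact: continuous_fst.
- apply: (sep _ (snd \o set_val)); first exact: metric_hausdorff.
  move=> z; apply: continuous_comp; first exact: cl_graph_val_continuous.
  exact: continuous_snd.
Qed.

Lemma lift_exists : exists h : cl_graph -> cl_graph,
  continuous h /\ forall x, h (graph_point x) = graph_point (f x).
Proof.
have [f_ fP] : exists f_ : 'I_n -> X -> X,
    forall i, continuous_extension f (A i) (f_ i).
  have [_ ext] := pcm_continuous f.
  by exists (fun i => sval (cid (ext i))) => i; case: cid.
pose F (z : X * shift_space R n) := (f_ (z.2 0%N) z.1, symbol_shift z.2).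
have F_graph x : F (x, coding x) = (f x, coding (f x)).
  rewrite /F /= coding_shift; congr (_, _).
  by apply: (fP _).2; exact: (codingP x 0).
have near_snd (z : X * shift_space R n) : nbhs z [set w | w.2 0%N = z.2 0%N].
  exact: (@continuous_snd _ _ z _ (near_symbol z.2)).
have cl_piece z : closure coding_graph z -> closure (A (z.2 0%N)) z.1.
  move=> clz U zU.
  have zU' : nbhs z [set w | U w.1] by exact: (@continuous_fst _ _ z _ zU).
  have [_ [[x _ <-] /= [Ux <-]]] := clz _ (filterI zU' (near_snd z)).
  by exists x; split => //; exact: (codingP x 0).
have cF : {within closure coding_graph, continuous F}.
  apply/subspace_continuousP => z clz; apply: cvg_to_pair; last first.
    apply: cvg_within_filter; apply: continuous_comp; first exact: continuous_snd.
    exact: shift_continuous.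
  move=> W /= zW.
  have [/subspace_continuousP/(_ _ (cl_piece _ clz)) fz _] := fP (z.2 0%N).
  have {}fz : nbhs z.1 [set y | closure (A (z.2 0%N)) y -> W (f_ (z.2 0%N) y)].
    exact: (fz _ zW).
  have {}fz : nbhs z [set w |
      closure (A (z.2 0%N)) w.1 -> W (f_ (z.2 0%N) w.1)].
    exact: (@continuous_fst _ _ z _ fz).
  suff : nbhs z [set w | closure coding_graph w -> W (f_ (w.2 0%N) w.1)] by [].
  apply: filterS2 fz (near_snd z) => w /= Hw w2 clw.
  by rewrite w2; apply: Hw; rewrite -w2; exact: cl_piece.
have F_closure z : closure coding_graph z -> closure coding_graph (F z).
  move=> clz U FzU; move/subspace_continuousP/(_ _ clz): cF => cFz.
  have {}cFz : nbhs z [set w | closure coding_graph w -> U (F w)].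
    exact: (cFz _ FzU).
  have [_ [[x _ <-] Ux]] := clz _ cFz.
  exists (F (x, coding x)); split; first by rewrite F_graph; exists (f x).
  by apply: Ux; apply: set_mem; exact: coding_graph_closure.
pose h (z : cl_graph) : cl_graph :=
  exist _ (F (set_val z)) (mem_set (F_closure _ (set_mem (valP z)))).
exists h; split; last by move=> x; apply: val_inj; rewrite /= F_graph.
apply: continuous_comp_initial.
exact/subspace_sigL_continuousP.
Qed.

(* The continuous extension of (x, tau(x)) |-> (f(x), tau(f(x))) to cl(G_X); it *)
(* is unique, since G_X is dense and cl(G_X) is Hausdorff.                      *)
Definition lift_map : cl_graph -> cl_graph := sval (cid lift_exists).

Lemma lift_map_continuous : continuous lift_map.
Proof. by rewrite /lift_map; case: cid => h []. Qed.

Lemma lift_graph_point (x : X) : lift_map (graph_point x) = graph_point (f x).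
Proof. by rewrite /lift_map; case: cid => h []. Qed.

Definition lift_set (N : set X) : set cl_graph := closure (graph_point @` N).

Definition pcm_conley_index (N : set X) : ob (Sz (hTop R)) -> Prop :=
  conley_index cl_graph_hausdorff lift_map_continuous
    (invariant_part lift_map (lift_set N)).

End pcm.

(* Main.v *)
(* If the lift has no full orbit in the lift of N, then by compactness some     *)
(* iterate of every index map is constant, so the index is trivial. Otherwise   *)
(* let z_k be a full orbit of the lift, x_k its projection to X and s_k its     *)
(* zeroth symbol: x_k lies in cl(A_(s_k)) and f_(s_k) sends x_k to x_(k+1).     *)
(* Recoding each x_k by s_k gives a map adjoint with f having x_k as an orbit,  *)
(* provided no point is visited twice; if one is, a shortest loop of the orbit, *)
(* repeated forever, is used instead.                                           *)
Require Import Defs.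
From mathcomp Require Import all_boot all_order all_algebra.
From mathcomp Require Import all_classical all_reals all_analysis.
From mathcomp Require Import fingroup perm zify.
Import Order.TTheory GRing.Theory Num.Theory numFieldNormedType.Exports.

Set Implicit Arguments.
Unset Strict Implicit.
Unset Printing Implicit Defensive.

Local Open Scope classical_set_scope.

(** The dichotomy is whether [lift_map] has a full orbit in [lift_set N]. Without one,
    [conley_index_empty] makes the index trivial: if for every [m] some point survived [m] steps of
    an index map, [invariant_part_compact] would give a full orbit in the compact set
    [closure (P1 \ P0)]. With one, [lift_map_fst] shows that its projection to [N] is driven by the
    extensions [f_ i], [loop_or_injective] makes the symbol a function of the point, and
    [adjoint_choice] turns that function into an adjoint map [g]. The case [g = f] gives the first
    alternative, [g <> f] the second. *)

Lemma isomorphic_trans (K : category) (a b c : ob K) :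
  isomorphic a b -> isomorphic b c -> isomorphic a c.
Proof.
have cancel (x y z : ob K) (u : Defs.hom x y) (u' : Defs.hom y x) (v : Defs.hom y z)
    (v' : Defs.hom z y) : heq (cmp u' u) (idm x) -> heq (cmp v' v) (idm y) ->
    heq (cmp (cmp u' v') (cmp v u)) (idm x).
  move=> uu vv; apply: heq_trans (heq_sym (cmpA _ _ _)) _.
  apply: heq_trans uu; apply: heq_cmp (heq_refl _) _.
  apply: heq_trans (cmpA _ _ _) _.
  exact: heq_trans (heq_cmp vv (heq_refl _)) (cmp1m _).
move=> [u [u' [u'u uu']]] [v [v' [v'v vv']]].
by exists (cmp v u), (cmp u' v'); split; exact: cancel.
Qed.

Lemma ultra_fmap (T U : Type) (f : T -> U) (F : set_system T) :
  UltraFilter F -> UltraFilter (f @ F).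
Proof.
move=> FU; split=> [|G GF FG]; first exact: fmap_proper_filter.
apply/seteqP; split=> [B GB|]; last exact: FG.
have [//|FnB] := in_ultra_setVsetC (f @^-1` B) FU.
by have [? []] := filter_ex (filterI GB (FG (~` B) FnB)).
Qed.

(** * Full orbits from long finite orbits in a compact set *)

Section compact_orbits.
Variables (Y : topologicalType) (h : Y -> Y).
Hypotheses (hY : hausdorff_space Y) (hc : continuous h).

(* Re-centre ever longer finite orbit segments at their midpoints and take the *)
(* limit of each coordinate along one nonprincipal ultrafilter.               *)
Lemma invariant_part_compact (K : set Y) : compact K ->
  (forall n, exists x, forall i, (i <= n)%N -> K (iter i h x)) ->
  invariant_part h K !=set0.
Proof.
rewrite compact_ultra => cK long.
have [x_ x_K] : exists x_ : nat -> Y,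
    forall n i, (i <= n.*2)%N -> K (iter i h (x_ n)).
  exists (fun n => sval (cid (long n.*2))) => n i.
  by case: cid => x /= xK; exact: xK.
have [U [UU ooU]] := ultraFilterLemma eventually_filter.
(* Position [k] relative to the midpoint, which is step [n] of [x_ n]. The absolute value is
   harmless once [|k| <= n], hence along [U]. *)
pose y (k : int) n := iter `|(n%:Z + k)%R|%N h (x_ n).
have far (k : int) : U [set n | (`|k| <= n)%N].
  by apply: ooU; exists `|k|%N.
have lim k : exists p, K p /\ y k @ U --> p.
  have [|p [Kp yp]] := cK (y k @ U) (ultra_fmap (y k) UU); last by exists p.
    change (U (y k @^-1` K)).
    by apply: filterS (far k) => n /= kn; apply: x_K; lia.
have [p_ p_P] : exists p_ : int -> Y, forall k, K (p_ k) /\ y k @ U --> p_ k.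
  by exists (fun k => sval (cid (lim k))) => k; case: cid.
exists (p_ 0%R), p_; split => // k; first by have [] := p_P k.
have [_ yk] := p_P k; have [_ yk1] := p_P (k + 1)%R.
apply: (cvg_unique hY (F := y (k + 1)%R @ U)) => //.
have hyk : (h \o y k) @ U --> h (p_ k) by apply: cvg_comp yk _; exact: hc.
apply: cvg_trans hyk; apply: near_eq_cvg.
apply: filterS (far k) => n /= kn; rewrite /y.
by have -> : `|(n%:Z + (k + 1))%R|%N = `|(n%:Z + k)%R|%N.+1 by lia.
Qed.

End compact_orbits.

(** * Triviality in the Szymczak category *)

Section eventually_constant.
Variables (R : realType) (Z : topologicalType).

Lemma eqfun_homotopic (T U : topologicalType) (u v : continuousType T U) :
  u =1 v -> homotopic R u v.
Proof. by move=> /funext uv; rewrite -uv; exact: homotopic_refl. Qed.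

Lemma iterm_iter (u : @Defs.hom (hTop R) Z Z) m :
  (iterm u m : continuousType Z Z) =1 iter m (u : continuousType Z Z).
Proof. by elim: m => //= m IH x; exact: congr1 (IH x). Qed.

(** The Szymczak category compares maps only after precomposition with an iterate of [g]. After
    [g^m], the identity and the constant map [z0] agree. *)
Lemma sz_object_eventually_cst (g : Z -> Z) (cg : continuous g) (z0 : Z) m :
  g z0 = z0 -> (forall z, iter m g z = z0) ->
  isomorphic (sz_object R cg) (sz_point R).
Proof.
move=> gz0 gm; pose pt := discrete_topology unit.
pose u : @Defs.hom (hTop R) Z pt :=
  (mkcts (@cst_continuous Z pt tt) : continuousType Z pt).
pose v : @Defs.hom (hTop R) pt Z :=
  (mkcts (@cst_continuous pt Z z0) : continuousType pt Z).
have uh : heq (cmp u (endo_map (sz_object R cg))) (cmp (endo_map (sz_point R)) u).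
  exact: eqfun_homotopic.
have vh : heq (cmp v (endo_map (sz_point R))) (cmp (endo_map (sz_object R cg)) v).
  by apply: eqfun_homotopic => x; exact: esym gz0.
exists (@EndoHom (hTop R) (sz_object R cg) (sz_point R) u uh, 0%N).
exists (@EndoHom (hTop R) (sz_point R) (sz_object R cg) v vh, 0%N); split.
  exists m; apply: eqfun_homotopic => x.
  exact: (etrans (iterm_iter (endo_map (sz_object R cg)) m x) (gm x)).
by exists 0%N; apply: eqfun_homotopic => -[].
Qed.

End eventually_constant.

(** * The index of the empty invariant set *)

Section empty_invariant_set.
Variables (R : realType) (Y : topologicalType) (h : Y -> Y).
Hypotheses (hY : hausdorff_space Y) (hc : continuous h).

(** The base point [None] is absorbing, so an orbit of the index map that avoids it is a genuine
    [h]-orbit in [P1 \ P0]. *)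
Lemma iter_index_map_Some (P1 P0 : set Y) m (z : pair_quotient P1 P0) p :
  iter m (@Defs.index_map Y h P1 P0) z = Some p ->
  exists y, set_val p = iter m h y /\
    forall i, (i <= m)%N -> (P1 `\` P0) (iter i h y).
Proof.
elim: m p => [|m IH] p /=.
  move=> _; exists (set_val p); split=> // i; rewrite leqn0 => /eqP -> /=.
  exact: set_mem (valP p).
case E : (iter m _ z) => [q|//]; have [y [qy yP]] := IH _ E.
rewrite /= /pair_class qy; case: pselect => // hy [<-]; exists y; split => // i.
by rewrite leq_eqVlt => /orP[/eqP ->//|]; exact: yP.
Qed.

Lemma index_map_nilpotent (P1 P0 : set Y) : index_pair h set0 P1 P0 ->
  exists m, forall z, iter m (@Defs.index_map Y h P1 P0) z = None.
Proof.
move=> [[cP1 cP0 P01] [[Inv0 _] _ _]]; apply: contrapT => nonnil.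
have : invariant_part h (closure (P1 `\` P0)) !=set0.
  apply: invariant_part_compact => // [|m].
    apply: (subclosed_compact _ cP1); first exact: closed_closure.
    by rewrite closureE => y; apply; split; [exact: compact_closed|move=> ? []].
  apply: contrapT => short; apply: nonnil; exists m => z.
  case E : (iter m _ z) => [p|//]; have [y [_ yP]] := iter_index_map_Some E.
  by case: short; exists y => i im; apply: subset_closure; exact: yP.
by rewrite -Inv0 => -[].
Qed.

Lemma index_object_empty (P1 P0 : set Y) (HP : index_pair h set0 P1 P0) :
  isomorphic (index_object R hY hc HP) (sz_point R).
Proof.
have [m nil] := index_map_nilpotent HP.
exact: (sz_object_eventually_cst R (index_map_continuous hY hc HP) _ nil).
Qed.

(** The index ranges over all index pairs, so besides the triviality of each pair one must exhibit
    one: the pair of empty sets. *)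
Lemma conley_index_empty :
  conley_index (R := R) hY hc set0 = fun Z => isomorphic Z (sz_point R).
Proof.
have P0 : index_pair h set0 set0 set0.
  split; first by split=> //; exact: compact0.
  split=> //; rewrite setD0 closure0; split=> //.
  by apply/seteqP; split => // x [x_ [_ /(_ 0%R)]].
apply/funext => Z; apply/propext; split.
  move=> [P1 [P0' [HP ZP]]]; apply: isomorphic_trans ZP _.
  exact: index_object_empty.
move=> Zpt; exists set0, set0, P0; apply: isomorphic_trans Zpt _.
have [u [v [vu uv]]] := index_object_empty P0.
by exists v, u.
Qed.

End empty_invariant_set.

(** The reparametrisation [kappa] lets a point of the orbit determine its index. If [x_] is not
    injective, [kappa] runs for ever through one loop of least length [p], whose [p] indices carry
    distinct points by minimality. *)
Lemma loop_or_injective (T : Type) (x_ : int -> T) :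
  exists kappa : int -> int,
    (forall i j, x_ (kappa i) = x_ (kappa j) -> kappa i = kappa j) /\
    forall j, x_ (kappa (j + 1)%R) = x_ (kappa j + 1)%R.
Proof.
have [inj|] := pselect (injective x_); first by exists id; split => // i j /inj.
move=> ninj.
pose loop p := `[< (0 < p)%N /\ exists k, x_ k = x_ (k + p)%R >].
have : exists p, loop p.
  apply: contrapT => noloop; apply: ninj => i j xij; apply: contrapT => ij.
  apply: noloop; exists `|(j - i)%R|%N; apply/asboolP; split; first by lia.
  have [lt_ij|le_ji] := ltP i j.
    by exists i; rewrite xij; congr x_; lia.
  by exists j; rewrite -xij; congr x_; lia.
move=> /ex_minnP[p /asboolP[p0 [k xk]] pmin].
pose kappa (j : int) := (k + modz j p)%R.
have mod_lt j : (0 <= modz j p < p)%R.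
  by rewrite modz_ge0 ?ltz_pmod //; lia.
exists kappa; split => [i j|j]; last first.
  rewrite /kappa.
  (* At the last index of the loop [kappa] jumps back to [k]; the points still match because
     [x_ k = x_ (k + p)]. *)
  have [E|E] := eqVneq (modz j p + 1)%R p.
    by rewrite -modzDml E modzz -addrA E addr0.
  rewrite -modzDml modz_small -?addrA //.
  by have := mod_lt j; lia.
rewrite /kappa => xij; apply: contrapT => ij.
have mod_i := mod_lt i; have mod_j := mod_lt j.
have short (a b : int) : (a < b)%R -> (b - a < p)%R -> x_ a <> x_ b.
  move=> ab bap xab; have : (p <= `|(b - a)%R|)%N; last by lia.
  apply: pmin; apply/asboolP; split; first by lia.
  by exists a; rewrite xab; congr x_; lia.
have [lt_ij|le_ji] := ltP (k + modz i p)%R (k + modz j p)%R.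
  by apply: short xij => //; lia.
by apply: short (esym xij); lia.
Qed.

(** * From orbits of the lift to orbits of adjoint maps *)

Section lifted_orbits.
Variables (R : realType) (X : metricType R) (f : pcm X).
Local Notation n := (pcm_size f).
Local Notation A := (@pcm_piece R X f).

(** The zeroth symbol is locally constant, so graph points close to [z] have their base point in the
    piece named by [z]. *)
Lemma closure_coding_graph_piece (z : X * shift_space R n) :
  closure (@coding_graph R X f) z -> closure (A (z.2 0%N)) z.1.
Proof.
move=> clz U zU.
have zU' : nbhs z [set w | U w.1] by exact: (@continuous_fst _ _ z _ zU).
have zs : nbhs z [set w | w.2 0%N = z.2 0%N].
  exact: (@continuous_snd _ _ z _ (near_symbol z.2)).
have [_ [[x _ <-] /= [Ux <-]]] := clz _ (filterI zU' zs).
by exists x; split => //; exact: (codingP f x 0).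
Qed.

Lemma cl_graph_fst_continuous : continuous (fun z : cl_graph f => (set_val z).1).
Proof.
move=> z; apply: (@continuous_comp _ _ _ (set_val : cl_graph f -> _) fst).
  exact: cl_graph_val_continuous.
exact: continuous_fst.
Qed.

(** Both sides are continuous along the graph points that share the zeroth symbol of [z], and at
    [(x, coding x)] both equal [f x]. Such points accumulate at [z], and [X] is Hausdorff. *)
Lemma lift_map_fst (f_ : 'I_n -> X -> X) (z : cl_graph f) :
  (forall i, continuous_extension f (A i) (f_ i)) ->
  (set_val (lift_map z)).1 = f_ ((set_val z).2 0%N) (set_val z).1.
Proof.
move=> fP; set w := set_val z; set i := w.2 0%N.
have clw : closure (@coding_graph R X f) w by exact: set_mem (valP z).
apply: (@metric_hausdorff R X) => U V wU wV.
have [W [oW Ww WU]] : exists W, [/\ open W, W w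
    & forall p : cl_graph f, W (set_val p) -> U (set_val (lift_map p)).1].
  have : nbhs z [set p : cl_graph f | U (set_val (lift_map p)).1].
    exact: (@lift_map_continuous R X f z _ (cl_graph_fst_continuous wU)).
  rewrite nbhsE => -[_ [[W oW <-] Wz] WU]; by exists W.
have fi : nbhs w.1 [set y | closure (A i) y -> V (f_ i y)].
  have [/subspace_continuousP/(_ _ (closure_coding_graph_piece clw)) + _] := fP i.
  exact.
have fi' : nbhs w [set q | closure (A i) q.1 -> V (f_ i q.1)].
  exact: (@continuous_fst _ _ w _ fi).
have si : nbhs w [set q | q.2 0%N = i].
  exact: (@continuous_snd _ _ w _ (near_symbol w.2)).
have Wn : nbhs w W by exact: open_nbhs_nbhs.
have [_ [[x _ <-] [[/= Wx Vx] xi]]] := clw _ (filterI (filterI Wn fi') si).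
have Aix : A i x by rewrite -xi; exact: (codingP f x 0).
exists (f x); split.
  by have := WU (graph_point f x) Wx; rewrite lift_graph_point.
rewrite -(proj2 (fP i) _ Aix); apply: Vx; exact: subset_closure.
Qed.

Lemma lift_set_fst (N : set X) (z : cl_graph f) :
  closed N -> lift_set N z -> N (set_val z).1.
Proof.
move=> clN Nz; apply: clN => U zU.
have : nbhs z [set p : cl_graph f | U (set_val p).1].
  exact: (cl_graph_fst_continuous zU).
by move=> /Nz[_ [[x Nx <-] Ux]]; exists x.
Qed.

(* Outside D the only piece whose closure contains x is the piece of x, so any *)
(* such choice c of closed pieces gives an adjoint map.                        *)
Lemma adjoint_choice (f_ : 'I_n -> X -> X) (c : X -> 'I_n) :
  (forall i, continuous_extension f (A i) (f_ i)) ->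
  (forall x, closure (A (c x)) x) -> adjoint_map f (fun x => f_ (c x) x).
Proof.
move=> fP cP; exists (fun i => [set x | c x = i]), 1%g.
have cE x i : ~ discontinuity_set f x -> closure (A i) x -> c x = i.
  move=> nDx Aix; apply/eqP/negPn/negP => ci; apply: nDx.
  by exists (c x), i.
split.
- split.
    split; last by apply/seteqP; split => // x _; exists (c x).
    by move=> i j _ _ [x [/= <- <-]].
  move=> i; rewrite perm1; apply/seteqP; split => x [/= xi nDx]; split => //.
    exact/cE/subset_closure.
  have [j Ajx] := pcm_cover f x.
  by rewrite -xi (cE x j) //; exact: subset_closure.
- by move=> i x; rewrite perm1 => /= <-.
- by move=> i; exists (f_ i) => // x; rewrite perm1 => /= ->.
Qed.

Lemma lifted_orbit_adjoint (N : set X) : closed N ->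
  invariant_part (@lift_map R X f) (lift_set N) !=set0 ->
  exists2 g, adjoint_map f g & invariant_part g N !=set0.
Proof.
move=> clN [_ [z_ [_ z_N z_S]]].
have [f_ fP] : exists f_ : 'I_n -> X -> X,
    forall i, continuous_extension f (A i) (f_ i).
  have [_ ext] := pcm_continuous f.
  by exists (fun i => sval (cid (ext i))) => i; case: cid.
pose x_ k := (set_val (z_ k)).1; pose s_ k := (set_val (z_ k)).2 0%N.
have x_S k : x_ (k + 1)%R = f_ (s_ k) (x_ k).
  by rewrite /x_ -z_S (lift_map_fst _ fP).
have x_A k : closure (A (s_ k)) (x_ k).
  exact: (closure_coding_graph_piece (set_mem (valP (z_ k)))).
have [kappa [kinj kS]] := loop_or_injective x_.
(* On the orbit the index [j] is an arbitrary choice, but [kinj] makes [kappa j], and so the symbol,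
   independent of it. Off the orbit [x] keeps its own piece. *)
pose c x : 'I_n := if pselect (exists j, x_ (kappa j) = x) is left e
  then s_ (kappa (sval (cid e))) else sval (cid (pcm_cover f x)).
have cx j : c (x_ (kappa j)) = s_ (kappa j).
  rewrite /c; case: pselect => [e|[]]; last by exists j.
  by case: cid => i /= /kinj ->.
exists (fun x => f_ (c x) x).
  apply: adjoint_choice => // x; rewrite /c; case: pselect => [e|_].
    by case: cid => j /= <-; exact: x_A.
  by case: cid => i /= Aix; exact: subset_closure.
exists (x_ (kappa 0%R)), (x_ \o kappa); split => //= k.
  exact: lift_set_fst (z_N _).
by rewrite cx kS x_S.
Qed.

End lifted_orbits.

Theorem proposition6p1 (R : realType) (X : metricType R)
    (X_locally_compact : locally_compact [set: X])
    (f : pcm X) (N : set X)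
    (N_compatible : compatible_isolating_neighborhood f N)
    (C_nontrivial : nontrivial_index (pcm_conley_index f N)) :
  invariant_part f N !=set0 \/
  exists g : X -> X, [/\ adjoint_map f g, g <> f & invariant_part g N !=set0].
Proof.
have [[cN _] _] := N_compatible.
have clN : closed N by apply: compact_closed => //; exact: metric_hausdorff.
have [|empty] := pselect (invariant_part (@lift_map R X f) (lift_set N) !=set0).
  move=> /(lifted_orbit_adjoint clN)[g adj gN].
  by have [<-|gf] := pselect (g = f); [left|right; exists g].
case: C_nontrivial; rewrite /pcm_conley_index.
have -> : invariant_part (@lift_map R X f) (lift_set N) = set0.
  by apply/eqP; apply: contrapT => /negP /set0P.
exact: conley_index_empty.
Qed.
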